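(* Let $N\ge3$, let $x_1,\dots,x_N\in\mathbb{R}^2$ be non-collinear (not all on one line) sensor positions, and let $C\subset\mathbb{R}^2$ be a compact region of area $A$ divided into compact regions $W_1,\dots,W_N$, with $W_j$ of area $A_j$. Let $s\in C$ be the source, with $s\notin W_j$, and let the measurements be $\ln P_{r_i}=\ln\frac{Pd_0}{d_0+\|x_i-s\|^\beta}+n_i$, $i\in\{1,\dots,N\}$, where $n_1,\dots,n_N$ are i.i.d. Gaussian with mean $0$ and variance $\sigma^2$. Then $$\mathrm{Prob}\Big[p(\ln P_{r_1},\dots,\ln P_{r_N}\mid H_j)P(H_j)\le\epsilon_j(\sigma)\Big]\ge\mu_j(\sigma),$$ where $$\epsilon_j(\sigma)=\frac{A_j\exp(-L_j/(4\sigma^2))}{A(2\pi\sigma^2)^{N/2}},\qquad \mu_j(\sigma)=\big(1-2Q(\eta_j/\sigma)\big)^N .$$ Furthermore, as $\sigma\to0^+$, $\epsilon_j(\sigma)\to0^+$ and $\mu_j(\sigma)\to1^-$.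
   Context: $P>0$, $d_0>0$, $\beta>2$, $\sigma>0$. $Q(x)=\frac{1}{\sqrt{2\pi}}\int_x^{+\infty}\exp(-y^2/2)\,dy$. $H_j$ is the hypothesis that the source lies in $W_j$, and (uniform prior of the source on $C$) $$p(\ln P_{r_1},\dots,\ln P_{r_N}\mid H_j)P(H_j)=\frac{1}{A(2\pi\sigma^2)^{N/2}}\int_{W_j}\exp\Big(-\frac{\sum_{i=1}^N\big(\ln P_{r_i}-\ln\frac{Pd_0}{d_0+\|y-x_i\|^\beta}\big)^2}{2\sigma^2}\Big)dy .$$ The constants (independent of $\sigma$) are any $U_j>0$, $L_j>0$ with $$U_j\ge\max_{y\in W_j,\ i\in\{1,\dots,N\}}\left|\ln\frac{d_0+\|y-x_i\|^\beta}{d_0+\|s-x_i\|^\beta}\right|,\qquad L_j\le\min_{y\in W_j}\sum_{i=1}^N\left(\ln\frac{d_0+\|y-x_i\|^\beta}{d_0+\|s-x_i\|^\beta}\right)^2,$$ (such $U_j,L_j$ exist because $s\notin W_j$, $W_j$ is compact and the sensors are non-collinear), and $\eta_j=\sqrt{U_j^2+\frac{L_j}{2N}}-U_j$. *)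

(* Defs.v *)
From HB Require Import structures.
From mathcomp Require Import all_boot all_order all_algebra.
From mathcomp Require Import all_classical all_reals all_analysis.
From mathcomp Require Import measurable_realfun measurable_fun_approximation.
From mathcomp Require Import ring lra.
Import Order.TTheory GRing.Theory Num.Theory numFieldNormedType.Exports.
Set Implicit Arguments.
Unset Strict Implicit.
Unset Printing Implicit Defensive.
Local Open Scope classical_set_scope.
Local Open Scope ring_scope.

(* The plane is [R * R]. Its library norm is the max norm, so the Euclidean
   distance is written out. *)
Definition edist {R : realType} (p q : R * R) : R :=
  Num.sqrt ((p.1 - q.1) ^+ 2 + (p.2 - q.2) ^+ 2).

Definition collinear {R : realType} {I : Type} (x : I -> R * R) : Prop :=
  exists a b c : R, (a, b) != (0, 0) /\
    forall i, a * (x i).1 + b * (x i).2 = c.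

(* Only applied to compact sets, whose Lebesgue measure is finite. *)
Definition area {R : realType} (S : set (R * R)) : R :=
  fine ((@lebesgue_measure R \x @lebesgue_measure R)%E S).

Definition plane_integral {R : realType} (S : set (R * R)) (f : R * R -> R) : R :=
  \int[(@lebesgue_measure R \x @lebesgue_measure R)%E]_(y in S) f y.

(* [C] is divided into the [W i]: they cover [C] and do not overlap, except
   possibly along their boundaries. *)
Definition divided_into {R : realType} {N : nat} (C : set (R * R))
    (W : 'I_N -> set (R * R)) : Prop :=
  \bigcup_i W i = C /\
  forall i k, i != k -> (W i)° `&` (W k)° = set0.

(* Noiseless value of [ln P_r] at a sensor in [x] for a source in [y]. *)
Definition ln_power {R : realType} (P d0 beta : R) (x y : R * R) : R :=
  ln (P * d0 / (d0 + edist y x `^ beta)).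

Definition ln_ratio {R : realType} (d0 beta : R) (s x y : R * R) : R :=
  ln ((d0 + edist y x `^ beta) / (d0 + edist s x `^ beta)).

(* Under the uniform prior of the source on [C], P(H_W) = |W| / |C|. *)
Definition prior {R : realType} (C W : set (R * R)) : R := area W / area C.

(* p(z | H_W): given that it lies in [W], the source is uniform on [W]; given
   its position [y], the entries of [z] are independent Gaussians. *)
Definition cond_density {R : realType} {N : nat} (P d0 beta sigma : R)
    (x : 'I_N -> R * R) (W : set (R * R)) (z : 'I_N -> R) : R :=
  (area W)^-1 * plane_integral W (fun y =>
    \prod_(i < N) normal_pdf (ln_power P d0 beta (x i) y) sigma (z i)).

Lemma measurable_ln_power (R : realType) (P d0 beta : R) (x : R * R) :
  0 < d0 -> measurable_fun [set: R * R] (ln_power P d0 beta x).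
Proof.
move=> d0_gt0.
have mE : measurable_fun [set: R * R] (fun y => edist y x).
  have msqrt : measurable_fun [set: R] (@Num.sqrt R).
    by apply: continuous_measurable_fun; exact: sqrt_continuous.
  apply: (measurableT_comp msqrt).
  by apply: measurable_funD; apply: measurable_funX; apply: measurable_funB.
apply: (measurableT_comp (@measurable_ln R)).
apply: measurable_funM => //.
rewrite (_ : (fun _ => _) = fun y => (d0 + edist y x `^ beta) `^ -1); last first.
  by apply/funext => y; rewrite powR_inv1// addr_ge0 ?powR_ge0 ?ltW.
apply: (measurableT_comp (measurable_powR _)).
apply: measurable_funD => //.
exact: measurableT_comp (measurable_powR beta) mE.
Qed.

(* The closed form of p(z | H_W) P(H_W) as a single integral over [W]. *)
Lemma cond_density_priorE (R : realType) (N : nat) (P d0 beta sigma : R)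
    (x : 'I_N -> R * R) (C W : set (R * R)) (z : 'I_N -> R) :
  0 < d0 -> 0 < sigma -> measurable W -> 0 < area W ->
  cond_density P d0 beta sigma x W z * prior C W =
  (area C * (2 * pi * sigma ^+ 2) `^ (N%:R / 2))^-1 *
  plane_integral W (fun y =>
    expR (- (\sum_(i < N) (z i - ln_power P d0 beta (x i) y) ^+ 2)
          / (2 * sigma ^+ 2))).
Proof.
move=> d0_gt0 s_gt0 mW aW_gt0.
rewrite /cond_density.
have v_gt0 : 0 < 2 * pi * sigma ^+ 2 :> R.
  by rewrite !mulr_gt0 ?pi_gt0 ?exprn_gt0.
set k : R := ((2 * pi * sigma ^+ 2) `^ (N%:R / 2))^-1.
have k_gt0 : 0 < k by rewrite invr_gt0 powR_gt0.
set g := fun y => expR _.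
have -> : plane_integral W (fun y =>
    \prod_(i < N) normal_pdf (ln_power P d0 beta (x i) y) sigma (z i)) =
  k * plane_integral W g.
  have -> : (fun y => \prod_(i < N)
      normal_pdf (ln_power P d0 beta (x i) y) sigma (z i)) =
    fun y => k * g y.
    apply/funext => y.
    under eq_bigr do rewrite normal_pdfE ?gt_eqF//.
    rewrite big_split/= prodr_const card_ord; congr *%R.
      rewrite /normal_peak /k exprVn; congr (_^-1).
      rewrite (_ : _ *+ 2 = 2 * pi * sigma ^+ 2); last by ring.
      rewrite -powR12_sqrt ?ltW// -[LHS]powR_mulrn ?powR_ge0// -powRrM.
      by rewrite [2^-1 * _]mulrC.
    rewrite /g mulNr mulr_suml -sumrN expR_sum; apply: eq_bigr => i _.
    by rewrite /normal_fun mulNr -[_ *+ 2]mulr_natl.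
  rewrite /plane_integral /Rintegral.
  under eq_integral do rewrite EFinM.
  rewrite ge0_integralZl//; last 3 first.
  - apply/measurable_EFinP/measurable_funTS; rewrite /g.
    apply: measurableT_comp => //; apply: measurable_funM => //.
    apply: measurableT_comp => //; apply: measurable_sum => i.
    apply: measurable_funX; apply: measurable_funB => //.
    exact: measurable_ln_power.
  - by move=> y _; rewrite lee_fin expR_ge0.
  - by rewrite lee_fin ltW.
  case: (integral _ _ _) => [r| |]; first by rewrite -EFinM.
    by rewrite gt0_muley ?lte_fin//= mulr0.
  by rewrite gt0_muleNy ?lte_fin//= mulr0.
rewrite /prior [(area C * _)^-1]invfM -/k; move: (area C)^-1 => c.
by field; rewrite gt_eqF.
Qed.

Definition Qfun {R : realType} (x : R) : R :=
  (Num.sqrt (2 * pi))^-1 *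
  \int[lebesgue_measure]_(y in `[x, +oo[) expR (- y ^+ 2 / 2).

Definition etaj {R : realType} (N : nat) (U L : R) : R :=
  Num.sqrt (U ^+ 2 + L / (2 * N%:R)) - U.

Definition epsj {R : realType} (N : nat) (A Aj L sigma : R) : R :=
  Aj * expR (- L / (4 * sigma ^+ 2)) /
  (A * (2 * pi * sigma ^+ 2) `^ (N%:R / 2)).

Definition muj {R : realType} (N : nat) (U L sigma : R) : R :=
  (1 - 2 * Qfun (etaj N U L / sigma)) ^+ N.

Definition mutually_independent {R : realType} {d : measure_display}
    {T : measurableType d} (Pr : probability T R) {I : finType}
    (X : I -> {RV Pr >-> R}) : Prop :=
  forall (J : {set I}) (B : I -> set R), (forall i, measurable (B i)) ->
    Pr (\bigcap_(i in [set` J]) X i @^-1` B i) =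
    (\prod_(i in J) Pr (X i @^-1` B i))%E.

(* The second parameter of [normal_prob] is the standard deviation. *)
Definition iid_gaussian {R : realType} {d : measure_display}
    {T : measurableType d} (Pr : probability T R) {I : finType} (sigma : R)
    (X : I -> {RV Pr >-> R}) : Prop :=
  mutually_independent X /\
  forall i (B : set R), measurable B ->
    distribution Pr (X i) B = normal_prob 0 sigma B.

(* Main.v *)
Require Import Defs.
From HB Require Import structures.
From mathcomp Require Import all_boot all_order all_algebra.
From mathcomp Require Import all_classical all_reals all_analysis.
From mathcomp Require Import measurable_realfun.
From mathcomp Require Import ring lra.
Import Order.TTheory GRing.Theory Num.Theory numFieldNormedType.Exports.
Local Open Scope classical_set_scope.
Local Open Scope ring_scope.

(** Write [r_i] for [ln_ratio d0 beta s (x i) y], the difference at sensor [i]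
    between the noiseless measurements for the sources [s] and [y].  When the
    true source is [s], the exponent of the likelihood at a candidate [y] is
    [- \sum_i (n_i + r_i)^2 / (2 sigma^2)].  If every noise satisfies
    [|n_i| < eta], then
    [(n_i + r_i)^2 >= r_i^2 - 2 |n_i| |r_i| >= r_i^2 - 2 U eta], whence
    [\sum_i (n_i + r_i)^2 >= L - 2 N U eta], and [eta] is the positive root of
    [N (eta^2 + 2 U eta) = L / 2], so that the sum is at least [L / 2]
    ([noisy_sum_sqr_ge]).  The integrand over [W] is then at most
    [expR (- L / (4 sigma^2))], which is the announced bound ([likelihood_le]).
    By independence the event that all the noises are smaller than [eta] has
    probability [(1 - 2 Q (eta / sigma))^N] ([iid_gaussian_small]), since
    scaling and symmetry turn the two tails of a centred Gaussian into [Q]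
    ([normal_prob_symitv]).

    Comparing the probabilities of the two events requires that both be
    measurable.  For the event on the likelihood this is Tonelli's theorem
    ([plane_integral_measurable]), once compact subsets of the plane are known
    to belong to the product sigma-algebra ([compact_plane_measurable]).

    For the limits, [expR (- t) <= (N / t)^N] beats the factor
    [sigma^-N] in [epsj] ([epsj_bounds]), and [Q] is positive and vanishes at
    infinity, so that [muj] tends to [1] while staying below it ([cvg_muj]). *)

(** * Compact subsets of the plane *)

(** An open set is the union of the balls of rational centre and radius
    [1 / (k + 1)] that it contains.  There are countably many of them, and
    each is a product of two intervals, hence measurable. *)
Lemma open_plane_measurable (R : realType) (O : set (R * R)) :
  open O -> measurable O.
Proof.
move=> oO.
pose F (t : rat * rat * nat) : set (R * R) :=
  ball (ratr t.1.1 : R) t.2.+1%:R^-1 `*` ball (ratr t.1.2 : R) t.2.+1%:R^-1.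
pose G t := if `[< F t `<=` O >] then F t else set0.
have -> : O = \bigcup_t G t.
  apply/seteqP; split=> [[a b] Oab|y [t _]]; last first.
    by rewrite /G; case: asboolP => // FO /FO.
  move: oO; rewrite openE => /(_ _ Oab) /nbhs_ballP[e/= e0 eO].
  have [k ke] : exists k : nat, k.+1%:R^-1 < e / 2 :> R.
    have e20 : 0 < e / 2 by rewrite divr_gt0.
    have [k _ /(_ _ (leqnn k))] := near_infty_natSinv_lt (PosNum e20).
    by exists k.
  have k0 : 0 < k.+1%:R^-1 :> R by rewrite invr_gt0.
  have app (c : R) : exists q : rat, ball (ratr q : R) k.+1%:R^-1 c.
    have /rat_in_itvoo[q] : c < c + k.+1%:R^-1 by rewrite ltrDl.
    rewrite in_itv/= => /andP[cq qc]; exists q.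
    by rewrite /ball/= gtr0_norm ?subr_gt0// ltrBlDr addrC.
  have [[p pa] [q qb]] := (app a, app b).
  exists (p, q, k) => //; rewrite /G; case: asboolP => [_|[]]; first by [].
  move=> [u v] [/= pu qv]; apply: eO; split => /=.
  - have := ball_triangle (ball_sym pa) pu; apply: le_ball.
    by rewrite [leRHS]splitr lerD// ltW.
  - have := ball_triangle (ball_sym qb) qv; apply: le_ball.
    by rewrite [leRHS]splitr lerD// ltW.
apply: countable_bigcupT_measurable => // t.
rewrite /G; case: asboolP => // _.
by apply: measurableX; exact: measurable_ball.
Qed.

Lemma compact_plane_measurable (R : realType) (K : set (R * R)) :
  compact K -> measurable K.
Proof.
move=> cK; have clK : closed K.
  by apply: compact_closed => //; exact: (@norm_hausdorff _ (R * R)%type).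
rewrite -(setCK K); apply: measurableC; apply: open_plane_measurable.
exact: closed_openC.
Qed.

(** Both coordinate projections are bounded on a compact set, which therefore
    lies in a rectangle. *)
Lemma compact_plane_finite (R : realType) (K : set (R * R)) : compact K ->
  ((@lebesgue_measure R \x @lebesgue_measure R) K < +oo)%E.
Proof.
move=> cK.
have bnd (f : R * R -> R) : continuous f ->
    exists M : R, forall y, K y -> `|f y| <= M.
  move=> cf; have cfK : compact (f @` K).
    by apply: continuous_compact => //; exact: continuous_subspaceT.
  have [M [_ HM]] := compact_bounded cfK.
  exists (M + 1) => y Ky; apply: (HM (M + 1)); first by rewrite ltrDl.
  by exists y.
have [A HA] := bnd fst (fun=> cvg_fst).
have [B HB] := bnd snd (fun=> cvg_snd).
apply: (@le_lt_trans _ _ ((@lebesgue_measure R \x @lebesgue_measure R)%E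
   (`[- A, A] `*` `[- B, B]))).
  apply: le_measure; rewrite ?inE//.
  - exact: compact_plane_measurable.
  - exact: measurableX.
  - by move=> y Ky; split; rewrite /= in_itv/= -ler_norml; auto.
rewrite product_measure1E//= !lebesgue_measure_itv/=.
by apply: lte_mul_pinfty; case: ifP; rewrite ?lte_fin ?ltry// => h;
  rewrite -?EFinD ?ltry// lee_fin; lra.
Qed.

(** * Tails of the Gaussian distribution *)

Lemma normal_pdf_scale (R : realType) (sigma x : R) : 0 < sigma ->
  normal_pdf 0 sigma x = normal_pdf 0 1 (x / sigma) / sigma.
Proof.
move=> s0; rewrite !normal_pdfE ?gt_eqF//.
rewrite /normal_peak /normal_fun !subr0 expr1n mul1r.
rewrite -mulrnAr sqrtrM ?sqr_ge0// sqrtr_sqr gtr0_norm// invfM mulrAC.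
rewrite mulrC mulrA [in RHS]mulrC mulrA; congr (_ * _).
  by rewrite mulrC.
congr expR; rewrite -mulr_natr; field; rewrite gt_eqF//.
Qed.

Lemma normal_prob_ge_scale (R : realType) (sigma a : R) : 0 < sigma ->
  normal_prob 0 sigma `[a, +oo[ = normal_prob 0 1 `[a / sigma, +oo[.
Proof.
move=> s0; rewrite /normal_prob.
pose F x : R := x / sigma.
have F' : F^`()%classic = cst sigma^-1.
  apply/funext => x; rewrite /F derive1E deriveM// derive_cst scaler0.
  by rewrite add0r derive_id scaler1.
rewrite (@increasing_ge0_integration_by_substitutiony _ F)//.
- by apply: eq_integral => x _; rewrite F' !fctE normal_pdf_scale.
- by move=> x y _ _ xy; rewrite ltr_pM2r ?invr_gt0.
- by rewrite F' => ? _; exact: cvg_cst.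
- by rewrite F'; exact: is_cvg_cst.
- by rewrite F'; exact: is_cvg_cst.
- split; first by [].
  by apply: cvg_at_right_filter; apply: cvgM; [exact: cvg_id|exact: cvg_cst].
- by apply/gt0_cvgMly; [rewrite invr_gt0|exact: cvg_id].
- apply: continuous_subspaceT; apply: continuous_normal_pdf; exact: oner_neq0.
- by move=> x _; exact: normal_pdf_ge0.
Qed.

Lemma normal_prob_le_opp (R : realType) (sigma a : R) :
  0 < sigma -> normal_prob 0 sigma `]-oo, - a] = normal_prob 0 sigma `[a, +oo[.
Proof.
move=> s0; rewrite /normal_prob.
rewrite ge0_integration_by_substitutionNy//; last 2 first.
- by apply: continuous_subspaceT; apply: continuous_normal_pdf; rewrite gt_eqF.
- by move=> x _; exact: normal_pdf_ge0.
apply: eq_integral => x _; congr EFin.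
by rewrite /= !normal_pdfE ?gt_eqF// /normal_fun !subr0 sqrrN.
Qed.

Lemma QfunE (R : realType) (x : R) : (Qfun x)%:E = normal_prob 0 1 `[x, +oo[.
Proof.
have pdfE (y : R) :
    normal_pdf 0 1 y = (Num.sqrt (2 * pi))^-1 * expR (- y ^+ 2 / 2).
  rewrite normal_pdfE ?oner_neq0//.
  by rewrite /normal_peak /normal_fun subr0 expr1n mul1r mulr_natl.
rewrite /Qfun /normal_prob.
have i1 : (@lebesgue_measure R).-integrable `[x, +oo[
    (fun y => (normal_pdf 0 1 y)%:E).
  by apply: (integrableS _ _ (subsetT _)) => //; exact: integrable_normal_pdf.
have c0 : Num.sqrt (2 * pi) != 0 :> R.
  by rewrite gt_eqF// sqrtr_gt0 mulr_gt0 ?pi_gt0.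
rewrite -RintegralZl//; last first.
  have -> : EFin \o (fun y : R => expR (- y ^+ 2 / 2)) =
     (fun y => (Num.sqrt (2 * pi))%:E * (normal_pdf 0 1 y)%:E)%E.
    by apply/funext => y; rewrite /= pdfE -EFinM mulVKf.
  exact: integrableZl.
rewrite /Rintegral fineK; last first.
  under eq_integral do rewrite -pdfE.
  exact: (@fin_num_measure _ _ _ (@normal_prob R 0 1)).
by apply: eq_integral => y _; rewrite pdfE.
Qed.

(** The complement of [`]- a, a[] consists of two tails, equal by symmetry. *)
Lemma normal_prob_symitv (R : realType) (sigma a : R) : 0 < sigma -> 0 < a ->
  normal_prob 0 sigma `]- a, a[ = (1 - 2 * Qfun (a / sigma))%:E.
Proof.
move=> s0 a0; rewrite -[`]-a, a[%classic]setCK.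
rewrite (@probability_setC _ _ _ (@normal_prob R 0 sigma)); last first.
  exact: measurableC.
rewrite (_ : ~` _ = `]-oo, - a] `|` `[a, +oo[); last first.
  apply/seteqP; split => y /=; rewrite !in_itv/= andbT.
    by move=> /negP; rewrite negb_and -!leNgt => /orP[]; [left|right].
  by move=> [ya|ay] /andP[]; rewrite ltNge ?ya// => _; rewrite ltNge ay.
rewrite measureU//=; last first.
  apply/seteqP; split => y //=; rewrite !in_itv/= andbT => -[ya ay].
  move: (le_trans ay ya); rewrite -subr_le0 opprK -mulr2n pmulrn_lle0//.
  by rewrite leNgt a0.
by rewrite normal_prob_le_opp// normal_prob_ge_scale// -QfunE mulr_natl.
Qed.

(** The density is at least its value at [x + 1] on [`[x, x + 1]]. *)
Lemma Qfun_gt0 (R : realType) (x : R) : 0 <= x -> 0 < Qfun x.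
Proof.
move=> x0; rewrite -lte_fin QfunE /normal_prob.
set m := normal_pdf 0 1 (x + 1).
have m0 : 0 < m.
  rewrite /m normal_pdfE ?oner_neq0// mulr_gt0 ?expR_gt0//.
  by rewrite normal_peak_gt0 ?oner_neq0.
apply: (@lt_le_trans _ _
  (\int[lebesgue_measure]_(y in `[x, (x + 1)%R]) m%:E)%E).
  rewrite integral_cst//= lebesgue_measure_itv/= lte_fin ltrDl ltr01.
  by rewrite -EFinB -EFinM lte_fin mulr_gt0// subr_gt0 ltrDl.
apply: (@le_trans _ _
  (\int[lebesgue_measure]_(y in `[x, (x + 1)%R]) (normal_pdf 0 1 y)%:E)%E).
  apply: ge0_le_integral => //=.
  - by move=> y _; rewrite lee_fin ltW.
  - by apply/measurable_EFinP/measurable_funTS; exact: measurable_normal_pdf.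
  - move=> y; rewrite in_itv/= => /andP[xy yx].
    rewrite lee_fin /m !normal_pdfE ?oner_neq0//.
    rewrite ler_pM2l ?normal_peak_gt0 ?oner_neq0//.
    rewrite /normal_fun ler_expR !subr0 !mulNr lerN2 ler_pM2r ?invr_gt0//.
      by rewrite ler_sqr ?nnegrE//; lra.
apply: ge0_subset_integral => //=.
- by apply/measurable_EFinP/measurable_funTS; exact: measurable_normal_pdf.
- by move=> y _; rewrite lee_fin normal_pdf_ge0.
- by apply: subset_itvl; rewrite bnd_simp.
Qed.

(** By symmetry [Qfun x] is the value at [- x] of the cumulative distribution
    function of the standard Gaussian. *)
Lemma cvg_Qfun_pinfty (R : realType) : Qfun x @[x --> +oo%R] --> (0 : R).
Proof.
pose mu : probability (measurableTypeR R) R := @normal_prob R 0 1.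
have mid : measurable_fun setT (idfun : measurableTypeR R -> R).
  exact: (@measurable_id _ _ setT).
pose X : {RV mu >-> R} := @mfun_Sub _ _ (measurableTypeR R)
  (R : measurableType _) idfun (mem_set mid).
have QE (x : R) : (Qfun x)%:E = cdf X (- x).
  by rewrite QfunE -normal_prob_le_opp.
have /fine_cvg := @cvg_cdfNy0 _ _ _ _ X; rewrite cvgNy_compNP.
suff -> : (fine \o cdf X) \o -%R = @Qfun R by [].
by apply/funext => x; exact: (esym (congr1 fine (QE x))).
Qed.

(** * Limits of the bounds as the noise vanishes *)

Lemma cvg_to_at_left (R : realType) (T : Type) (F : set_system T)
    (FF : Filter F) (f : T -> R) (l : R) :
  f @ F --> l -> (\forall t \near F, f t < l) -> f @ F --> l^'-.
Proof.
move=> fl flt A; rewrite /at_left /within/= => Al.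
have := fl _ Al; apply: filterS2 flt => t ft; exact.
Qed.

Lemma cvg_to_at_right (R : realType) (T : Type) (F : set_system T)
    (FF : Filter F) (f : T -> R) (l : R) :
  f @ F --> l -> (\forall t \near F, l < f t) -> f @ F --> l^'+.
Proof.
move=> fl flt A; rewrite /at_right /within/= => Al.
have := fl _ Al; apply: filterS2 flt => t ft; exact.
Qed.

(** The inequality [1 + u <= expR u] at [u = t / N], raised to the power [N]. *)
Lemma expRN_le_inv (R : realType) (N : nat) (t : R) : (0 < N)%N -> 0 < t ->
  expR (- t) <= (N%:R / t) ^+ N.
Proof.
move=> N0 t0; have N0R : 0 < N%:R :> R by rewrite ltr0n.
rewrite expRN -[leRHS]invrK.
rewrite lef_pV2 ?posrE ?expR_gt0 ?invr_gt0 ?exprn_gt0 ?divr_gt0//.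
rewrite -exprVn invf_div.
have -> : expR t = expR (t / N%:R) ^+ N.
  by rewrite -expRM_natl mulrC divfK ?gt_eqF.
rewrite lerXn2r ?nnegrE ?expR_ge0 ?divr_ge0 ?(ltW t0)//.
by apply: le_trans (expR_ge1Dx _); rewrite lerDr.
Qed.

(** With [v = 2 pi sigma^2], the exponential in [epsj] is [expR (- t)] for
    [t = pi L / (2 v)].  Bounding it by [(N / t)^N], which is of order [v^N],
    leaves a factor [sqrt v ^ N] after the division by [sqrt v ^ N]; this
    factor vanishes with [sigma]. *)
Lemma epsj_bounds (R : realType) (N : nat) (A Aj L sigma : R) : (0 < N)%N ->
  0 < A -> 0 < Aj -> 0 < L -> 0 < sigma ->
  0 < epsj N A Aj L sigma <=
  Aj * (2 * N%:R / (pi * L)) ^+ N / A * Num.sqrt (2 * pi * sigma ^+ 2) ^+ N.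
Proof.
move=> N0 A0 Aj0 L0 s0; rewrite /epsj.
have N0R : 0 < N%:R :> R by rewrite ltr0n.
(* [field] would unfold [pi], whose only relevant property is positivity. *)
move: (pi : R) (pi_gt0 R) => p p0.
have v0 : 0 < 2 * p * sigma ^+ 2 by rewrite !mulr_gt0 ?exprn_gt0.
rewrite [_ / 2]mulrC powRrM powR12_sqrt ?(ltW v0)// powR_mulrn ?sqrtr_ge0//.
set r := Num.sqrt _; have r0 : 0 < r by rewrite sqrtr_gt0.
have r2 : r ^+ 2 = 2 * p * sigma ^+ 2 by rewrite sqr_sqrtr// ltW.
have rN : 0 < r ^+ N by rewrite exprn_gt0.
apply/andP; split; first by rewrite divr_gt0 ?mulr_gt0 ?expR_gt0.
have -> : - L / (4 * sigma ^+ 2) = - (L * p / 2 / r ^+ 2).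
  rewrite r2; field; rewrite !gt_eqF//.
have t0 : 0 < L * p / 2 / r ^+ 2.
  by rewrite divr_gt0 ?exprn_gt0// divr_gt0 ?mulr_gt0.
have := @expRN_le_inv R N _ N0 t0.
have -> : N%:R / (L * p / 2 / r ^+ 2) = 2 * N%:R / (p * L) * r * r.
  by field; rewrite !gt_eqF//.
rewrite !exprMn => h; rewrite ler_pdivrMr ?mulr_gt0//.
apply: (le_trans (ler_wpM2l (ltW Aj0) h)).
by rewrite le_eqVlt; apply/orP; left; apply/eqP; field; rewrite gt_eqF.
Qed.

Lemma cvg_epsj (R : realType) (N : nat) (A Aj L : R) : (0 < N)%N ->
  0 < A -> 0 < Aj -> 0 < L ->
  epsj N A Aj L sigma @[sigma --> 0^'+] --> 0^'+.
Proof.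
move=> N0 A0 Aj0 L0; apply: cvg_to_at_right; last first.
  near=> sigma.
  have s0 : 0 < sigma by near: sigma; exact: nbhs_right_gt.
  by have /andP[] := @epsj_bounds R N A Aj L sigma N0 A0 Aj0 L0 s0.
set K := Aj * (2 * N%:R / (pi * L)) ^+ N / A.
apply: (@squeeze_cvgr _ _ _ _ (cst 0)
  (fun sigma => K * Num.sqrt (2 * pi * sigma ^+ 2) ^+ N)).
- near=> sigma.
  have s0 : 0 < sigma by near: sigma; exact: nbhs_right_gt.
  by have /andP[/ltW -> ->] := @epsj_bounds R N A Aj L sigma N0 A0 Aj0 L0 s0.
- exact: cvg_cst.
apply: cvg_at_right_filter.
rewrite -[X in _ --> X](_ : K * Num.sqrt (2 * pi * 0 ^+ 2) ^+ N = 0 :> R);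
  last first.
  by rewrite expr0n/= mulr0 sqrtr0 expr0n gtn_eqF// mulr0.
apply: cvgM; first exact: cvg_cst.
apply: (cvg_comp _ (fun t : R => t ^+ N)); last exact: exprn_continuous.
apply: (cvg_comp _ (@Num.sqrt R)); last exact: sqrt_continuous.
by apply: cvgM; [exact: cvg_cst|exact: exprn_continuous].
Unshelve. all: by end_near. Qed.

Lemma etaj_gt0 (R : realType) (N : nat) (U L : R) : (0 < N)%N ->
  0 <= U -> 0 < L -> 0 < etaj N U L.
Proof.
move=> N0 U0 L0; rewrite /etaj subr_gt0 -{1}(ger0_norm U0) -sqrtr_sqr ltr_sqrt.
  by rewrite ltrDl divr_gt0 ?mulr_gt0 ?ltr0n.
by rewrite ltr_wpDl ?sqr_ge0 ?divr_gt0 ?mulr_gt0 ?ltr0n.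
Qed.

(** The limit is approached from below because [0 < 2 Q < 1] as soon as
    [sigma] is small enough. *)
Lemma cvg_muj (R : realType) (N : nat) (U L : R) : (0 < N)%N ->
  0 <= U -> 0 < L -> muj N U L sigma @[sigma --> 0^'+] --> 1^'-.
Proof.
move=> N0 U0 L0; have e0 := etaj_gt0 R N U L N0 U0 L0.
have Qcvg : Qfun (etaj N U L / sigma) @[sigma --> 0^'+] --> (0 : R).
  apply: (cvg_comp _ (@Qfun R)); last exact: cvg_Qfun_pinfty.
  apply: gt0_cvgMry => //.
  apply/(@cvgrVy _ _ _ _ id); last exact: cvg_within.
  by near=> t; near: t; exact: nbhs_right_gt.
apply: cvg_to_at_left.
  rewrite -[X in _ --> X](_ : (1 - 2 * 0) ^+ N = 1 :> R); last first.
    by rewrite mulr0 subr0 expr1n.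
  apply: (cvg_comp _ (fun t : R => t ^+ N)); last exact: exprn_continuous.
  apply: cvgB; first exact: cvg_cst.
  by apply: cvgM => //; exact: cvg_cst.
near=> sigma.
have s0 : 0 < sigma by near: sigma; exact: nbhs_right_gt.
have Q0 : 0 < Qfun (etaj N U L / sigma) by rewrite Qfun_gt0// divr_ge0 ?ltW.
have Q1 : Qfun (etaj N U L / sigma) < 1 / 2.
  by near: sigma; apply: (cvgr_lt _ Qcvg).
rewrite /muj exprn_ilt1 ?gtn_eqF//; lra.
Unshelve. all: by end_near. Qed.

(** * Integrals over a region of the plane *)

(** Tonelli's theorem, applied to one coordinate of the plane at a time. *)
Lemma plane_integral_measurable (R : realType) d (T : measurableType d)
    (W : set (R * R)) (f : T -> R * R -> R) : measurable W ->
  measurable_fun setT (fun t : T * (R * R) => f t.1 t.2) ->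
  (forall w y, 0 <= f w y) ->
  measurable_fun setT (fun w => plane_integral W (f w)).
Proof.
move=> mW mf f0.
pose g (t : T * (R * R)) : \bar R := (f t.1 t.2 * \1_W t.2)%:E.
have mg : measurable_fun setT g.
  apply/measurable_EFinP; apply: measurable_funM => //.
  by apply: measurableT_comp => //; exact: measurable_indic.
have g0 t : (0 <= g t)%E by rewrite lee_fin mulr_ge0.
(* [measurableTypeR R] is [R] with the sigma-algebra on which the Lebesgue
   measure is declared. *)
pose RT := measurableTypeR R.
pose leb := @lebesgue_measure R.
pose h (t : (T * RT) * RT) : \bar R := g (t.1.1, (t.1.2, t.2)).
have mh : measurable_fun setT h.
  apply: (@measurableT_comp _ _ _ _ _ _ (g : T * (RT * RT) -> \bar R)).
    exact: mg.
  apply: measurable_fun_pair; first exact: measurableT_comp.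
  by apply: measurable_fun_pair => //; exact: measurableT_comp.
have mh1 :=
  @measurable_fun_fubini_tonelli_F _ _ _ _ R leb h mh (fun=> g0 _).
have h10 t : (0 <= fubini_F leb h t)%E.
  by apply: integral_ge0 => y _; exact: g0.
have mh2 := @measurable_fun_fubini_tonelli_F _ _ T _ R leb _ mh1 h10.
rewrite (_ : (fun w => _) = fine \o fubini_F leb (fubini_F leb h)).
  by apply: measurableT_comp.
apply/funext => w; rewrite /plane_integral /Rintegral /=; congr fine.
transitivity (\int[leb \x leb]_y g (w, y))%E.
  rewrite integral_mkcond; apply: eq_integral => y _.
  by rewrite /g/= patchE indicE; case: ifP => _; rewrite ?mulr1 ?mulr0.
have mgw : measurable_fun setT ((fun y => g (w, y)) : RT * RT -> \bar R).
  by apply: (@measurableT_comp _ _ _ _ _ _ (g : T * (RT * RT) -> \bar R)).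
by rewrite (@fubini_tonelli1 _ _ _ _ R leb leb _ mgw).
Qed.

Lemma plane_integral_le (R : realType) (W : set (R * R)) (f : R * R -> R)
    (c : R) :
  measurable W -> ((@lebesgue_measure R \x @lebesgue_measure R) W < +oo)%E ->
  measurable_fun setT f -> (forall y, 0 <= f y) -> 0 <= c ->
  (forall y, W y -> f y <= c) -> plane_integral W f <= area W * c.
Proof.
move=> mW Woo mf f0 c0 fc; rewrite /plane_integral /Rintegral /area.
set mu := (_ \x _)%E.
have Wfin : mu W \is a fin_num by rewrite ge0_fin_numE.
have intW : (\int[mu]_(y in W) (f y)%:E <= c%:E * mu W)%E.
  rewrite -integral_cst//; apply: ge0_le_integral => //=.
  - by move=> y _; rewrite lee_fin.
  - by apply/measurable_EFinP/measurable_funTS.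
have -> : fine (mu W) * c = fine (c%:E * mu W)%E by rewrite fineM// mulrC.
apply: (fine_le _ _ intW) => //; last by rewrite fin_numM.
rewrite ge0_fin_numE; last by apply: integral_ge0 => y _; rewrite lee_fin.
by apply: le_lt_trans intW _; rewrite -(fineK Wfin) -EFinM ltry.
Qed.

(** * The likelihood at a wrong location *)

(** Each term is at least [r_i^2 - 2 U eta], and [etaj N U L] is the positive
    solution [eta] of [N (eta^2 + 2 U eta) = L / 2]. *)
Lemma noisy_sum_sqr_ge (R : realType) (N : nat) (U L : R) (r n : 'I_N -> R) :
  (0 < N)%N -> 0 <= U -> 0 <= L ->
  (forall i, `|r i| <= U) -> L <= \sum_(i < N) r i ^+ 2 ->
  (forall i, `|n i| < etaj N U L) ->
  L / 2 <= \sum_(i < N) (n i + r i) ^+ 2.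
Proof.
move=> N0 U0 L0 rU Lr neta.
have N0R : 0 < N%:R :> R by rewrite ltr0n.
set e := etaj N U L in neta.
have e2 : N%:R * (e ^+ 2 + 2 * U * e) = L / 2.
  have q0 : 0 <= U ^+ 2 + L / (2 * N%:R).
    by rewrite addr_ge0 ?sqr_ge0// divr_ge0// mulr_ge0// ltW.
  have := sqr_sqrtr q0; rewrite /e /etaj; set q := Num.sqrt _ => hq.
  transitivity (N%:R * (q ^+ 2 - U ^+ 2)); first by ring.
  by rewrite hq; field; rewrite gt_eqF.
have termge i : r i ^+ 2 - 2 * U * e <= (n i + r i) ^+ 2.
  have := rU i; have := neta i.
  rewrite ltr_norml ler_norml => /andP[h1 h2] /andP[h3 h4].
  have : - (U * e) <= n i * r i.
    rewrite -lerN2 opprK; apply: le_trans (ler_norm _) _.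
    by rewrite normrN normrM mulrC ler_pM// ?ler_norml ?ltr_norml ?h3 ?h4 ?ltW.
  have := sqr_ge0 (n i); nra.
apply: (@le_trans _ _ (\sum_(i < N) (r i ^+ 2 - 2 * U * e))); last first.
  exact: ler_sum.
rewrite sumrB sumr_const card_ord -mulr_natl.
have : 0 <= N%:R * e ^+ 2 by rewrite mulr_ge0 ?sqr_ge0 ?ltW.
nra.
Qed.

Lemma ln_power_diff (R : realType) (P d0 beta : R) (x s y : R * R) :
  0 < P -> 0 < d0 ->
  ln_power P d0 beta x s - ln_power P d0 beta x y = ln_ratio d0 beta s x y.
Proof.
move=> P0 d00; rewrite /ln_power /ln_ratio.
have pos z : 0 < d0 + Defs.edist z x `^ beta by rewrite ltr_wpDr ?powR_ge0.
by rewrite !ln_div ?posrE ?mulr_gt0// opprB addrC addrA subrK.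
Qed.

(** The event is an intersection of independent events, one for each noise. *)
Lemma iid_gaussian_small (R : realType) d (T : measurableType d)
    (Pr : probability T R) (I : finType) (sigma e : R)
    (n : I -> {RV Pr >-> R}) :
  0 < sigma -> 0 < e -> iid_gaussian sigma n ->
  Pr [set w | forall i, `|n i w| < e] =
  ((1 - 2 * Qfun (e / sigma)) ^+ #|I|)%:E.
Proof.
move=> s0 e0 [ind gauss].
have := ind [set: I]%SET (fun=> `]- e, e[%classic) (fun=> measurable_itv _).
rewrite (eq_bigr (fun=> (1 - 2 * Qfun (e / sigma))%:E)); last first.
  move=> i _; rewrite -normal_prob_symitv//; exact: gauss.
rewrite prodEFin prodr_const cardsT => <-; congr (Pr _).
apply/seteqP; split => [w nw i _|w nw i] /=.
  by rewrite in_itv/= -ltr_norml.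
by have := nw i; rewrite /= in_itv/= -ltr_norml; apply; rewrite inE.
Qed.

Lemma likelihood_measurable (R : realType) (N : nat) (P d0 beta sigma : R)
    (x : 'I_N -> R * R) (C W : set (R * R)) d (T : measurableType d)
    (z : 'I_N -> T -> R) :
  0 < d0 -> 0 < sigma -> measurable W -> 0 < area W ->
  (forall i, measurable_fun setT (z i)) ->
  measurable_fun setT (fun w =>
    cond_density P d0 beta sigma x W (z^~ w) * prior C W).
Proof.
move=> d00 s0 mW aW mz.
under eq_fun do rewrite cond_density_priorE//.
apply: measurable_funM => //.
apply: plane_integral_measurable => //.
apply: measurableT_comp => //; apply: measurable_funM => //.
apply: measurableT_comp => //; apply: measurable_sum => i.
apply: measurable_funX; apply: measurable_funB => //.
  exact: measurableT_comp.
by apply: measurableT_comp => //; exact: measurable_ln_power.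
Qed.

Lemma likelihood_le (R : realType) (N : nat) (P d0 beta sigma : R)
    (x : 'I_N -> R * R) (C W : set (R * R)) (s : R * R) (U L : R)
    (n : 'I_N -> R) :
  0 < P -> 0 < d0 -> (0 < N)%N -> 0 <= U -> 0 <= L -> 0 < sigma ->
  compact W -> 0 < area W -> 0 < area C ->
  (forall y i, W y -> `|ln_ratio d0 beta s (x i) y| <= U) ->
  (forall y, W y -> L <= \sum_(i < N) ln_ratio d0 beta s (x i) y ^+ 2) ->
  (forall i, `|n i| < etaj N U L) ->
  cond_density P d0 beta sigma x W (fun i => ln_power P d0 beta (x i) s + n i)
    * prior C W <= epsj N (area C) (area W) L sigma.
Proof.
move=> P0 d00 N0 U0 L0 s0 cW aW aC rU Lr neta.
have mW := compact_plane_measurable _ _ cW.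
have v0 : 0 < 2 * pi * sigma ^+ 2 :> R by rewrite !mulr_gt0 ?pi_gt0 ?exprn_gt0.
rewrite cond_density_priorE// /epsj mulrC ler_pM2r; last first.
  by rewrite invr_gt0 mulr_gt0 ?powR_gt0.
apply: plane_integral_le => //.
- exact: compact_plane_finite.
- apply: measurableT_comp => //; apply: measurable_funM => //.
  apply: measurableT_comp => //; apply: measurable_sum => i.
  apply: measurable_funX; apply: measurable_funB => //.
  exact: measurable_ln_power.
move=> y Wy; rewrite ler_expR !mulNr lerN2.
have -> : L / (4 * sigma ^+ 2) = L / 2 / (2 * sigma ^+ 2).
  by field; rewrite gt_eqF.
rewrite ler_pM2r; last by rewrite invr_gt0 mulr_gt0 ?exprn_gt0.
rewrite (eq_bigr (fun i => (n i + ln_ratio d0 beta s (x i) y) ^+ 2));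
  last first.
  move=> i _; rewrite -(@ln_power_diff R P d0 beta (x i) s y P0 d00).
  by rewrite addrAC addrC.
apply: (@noisy_sum_sqr_ge R N U L) => //; last exact: Lr.
by move=> i; exact: rU.
Qed.

(** * The probability bound and its limits *)

Theorem theoremV4 (R : realType) (P d0 beta : R) (N : nat)
    (x : 'I_N -> R * R) (C : set (R * R)) (W : 'I_N -> set (R * R))
    (j : 'I_N) (s : R * R) (U L : R)
    (P_gt0 : 0 < P) (d0_gt0 : 0 < d0) (beta_gt2 : 2 < beta)
    (N_ge3 : (3 <= N)%N) (x_noncollinear : ~ collinear x)
    (C_compact : compact C) (W_compact : forall i, compact (W i))
    (C_divided : divided_into C W) (Wj_area : 0 < area (W j))
    (s_in_C : C s) (s_notin_Wj : ~ W j s)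
    (U_gt0 : 0 < U) (L_gt0 : 0 < L)
    (U_ge : forall y i, W j y -> `|ln_ratio d0 beta s (x i) y| <= U)
    (L_le : forall y, W j y ->
      L <= \sum_(i < N) ln_ratio d0 beta s (x i) y ^+ 2) :
  (forall (sigma : R) (d : measure_display) (T : measurableType d)
     (Pr : probability T R) (n : 'I_N -> {RV Pr >-> R}),
     0 < sigma -> iid_gaussian sigma n ->
     ((muj N U L sigma)%:E <=
      Pr [set w | let lnPr := fun i => (ln_power P d0 beta (x i) s + n i w)%R in
                  (cond_density P d0 beta sigma x (W j) lnPr * prior C (W j) <=
                   epsj N (area C) (area (W j)) L sigma)%R])%E) /\
  (epsj N (area C) (area (W j)) L sigma @[sigma --> 0^'+] --> 0^'+) /\
  (muj N U L sigma @[sigma --> 0^'+] --> 1^'-).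
Proof.
have N0 : (0 < N)%N by apply: leq_trans N_ge3.
have mWj := compact_plane_measurable _ _ (W_compact j).
have aC : 0 < area C.
  apply: lt_le_trans Wj_area _; rewrite /area.
  have fin K : compact K ->
      (@lebesgue_measure R \x @lebesgue_measure R)%E K \is a fin_num.
    by move=> cK; rewrite ge0_fin_numE// compact_plane_finite.
  apply: fine_le; [exact: fin|exact: fin|].
  apply: le_measure; rewrite ?inE.
  - exact: mWj.
  - exact: compact_plane_measurable.
  - by case: C_divided => <- _ y Wy; exists j.
split; last first.
  by split; [exact: cvg_epsj|apply: cvg_muj => //; exact: ltW].
move=> sigma d T Pr n s0 gauss.
have e0 := etaj_gt0 R N U L N0 (ltW U_gt0) L_gt0.
have := iid_gaussian_small _ _ _ _ _ _ _ _ s0 e0 gauss.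
rewrite card_ord -/(muj N U L sigma) => <-.
apply: le_measure; rewrite ?inE.
- rewrite (_ : [set w | forall i, `|n i w| < etaj N U L] =
    \bigcap_(i in [set: 'I_N]) (n i @^-1` `]- etaj N U L, etaj N U L[));
    last first.
    apply/seteqP; split => w /= nw i; first by rewrite /= in_itv/= -ltr_norml.
    by have := nw i I; rewrite /= in_itv/= -ltr_norml.
  apply: fin_bigcap_measurable => // i _; rewrite -[X in measurable X]setTI.
  exact: measurable_funPT.
- pose f w := cond_density P d0 beta sigma x (W j)
    (fun i => ln_power P d0 beta (x i) s + n i w) * prior C (W j).
  rewrite (_ : ([set w | _] : set T) =
    f @^-1` `]-oo, epsj N (area C) (area (W j)) L sigma]); last first.
    by apply/seteqP; split => w /=; rewrite in_itv.
  rewrite -[X in measurable X]setTI.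
  apply: (@likelihood_measurable _ _ _ _ _ _ _ _ _ _ _
    (fun i w => ln_power P d0 beta (x i) s + n i w)) => // i.
  exact: measurable_funD.
- move=> w nw /=.
  by apply: (@likelihood_le R N P d0 beta sigma x C (W j) s U L) => //;
    exact: ltW.
Qed.
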